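(* Let $n\in\mathbb{N}$, let $\Phi_1,\dots,\Phi_n\in\mathcal{E}(I)$ and let $\alpha_1,\dots,\alpha_n\in\mathbb{R}$. Then $$\alpha_1\mathcal{A}_{\Phi_1}(I)+\cdots+\alpha_n\mathcal{A}_{\Phi_n}(I)\subseteq \mathcal{A}_{|\alpha_1|\Phi_1+\cdots+|\alpha_n|\Phi_n}(I),$$ i.e., if $f_i\in\mathcal{A}_{\Phi_i}(I)$ for $i=1,\dots,n$, then $\alpha_1f_1+\cdots+\alpha_nf_n\in\mathcal{A}_{|\alpha_1|\Phi_1+\cdots+|\alpha_n|\Phi_n}(I)$. In particular, for every $\Phi\in\mathcal{E}(I)$, the class $\mathcal{A}_\Phi(I)$ is convex and centrally symmetric, i.e., closed with respect to multiplication by $-1$.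
   Context: $I\subseteq\mathbb{R}$ is a nonempty open interval and $\ell(I)\in(0,\infty]$ is its length. $\mathcal{E}(I)$ is the set of all functions $\Phi:[0,\ell(I))\to[0,\infty)$ (called error functions). For $\Phi\in\mathcal{E}(I)$, a function $f:I\to\mathbb{R}$ is called $\Phi$-affine if for all $x,y\in I$ and $t\in[0,1]$, $$|f(tx+(1-t)y)-tf(x)-(1-t)f(y)|\leq t\Phi((1-t)|x-y|)+(1-t)\Phi(t|x-y|).$$ $\mathcal{A}_\Phi(I)$ denotes the class of all $\Phi$-affine functions on $I$. *)

(* Defs.v *)
From HB Require Import structures.
From mathcomp Require Import all_boot all_order all_algebra.
From mathcomp Require Import all_classical all_reals all_analysis.

Set Implicit Arguments.
Unset Strict Implicit.
Unset Printing Implicit Defensive.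

Import Order.TTheory GRing.Theory Num.Theory.
Import numFieldNormedType.Exports.

Local Open Scope classical_set_scope.
Local Open Scope ring_scope.

(* Functions on I, or on [0, l(I)[, are represented by total functions R -> R^o
   of which only the restriction to that domain is constrained: every class of
   functions below is invariant under changing values off the domain. *)

(* l(I): for an interval I, the supremum of I minus its infimum, in \bar R. *)
Definition interval_length (R : realType) (I : set R) : \bar R :=
  (ereal_sup (EFin @` I) - ereal_inf (EFin @` I))%E.

Definition error_functions (R : realType) (I : set R) : set (R -> R^o) :=
  [set Phi | forall u : R,
     0 <= u -> (u%:E < interval_length I)%E -> 0 <= (Phi u : R)].

Definition affine_class (R : realType) (I : set R) (Phi : R -> R^o) :
    set (R -> R^o) :=
  [set f | forall x y t : R, I x -> I y -> 0 <= t <= 1 ->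
     `|f (t * x + (1 - t) * y) - t * f x - (1 - t) * f y|
       <= t * Phi ((1 - t) * `|x - y|) + (1 - t) * Phi (t * `|x - y|)].

(* The Minkowski combination a_0 A_0 + ... + a_(n-1) A_(n-1). *)
Definition set_lincomb (R : pzRingType) (V : lmodType R) (n : nat)
    (a : 'I_n -> R) (A : 'I_n -> set V) : set V :=
  [set \sum_(i < n) a i *: v i | v in [set v : 'I_n -> V | forall i, A i (v i)]].

Definition centrally_symmetric (R : pzRingType) (V : lmodType R) (A : set V) :
    Prop :=
  forall v : V, A v -> A ((-1) *: v).

(* Main.v *)
Require Import Defs.
From HB Require Import structures.
From mathcomp Require Import all_boot all_order all_algebra.
From mathcomp Require Import all_classical all_reals all_analysis.
From mathcomp Require Import ring.

Set Implicit Arguments.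
Unset Strict Implicit.
Unset Printing Implicit Defensive.

Import Order.TTheory GRing.Theory Num.Theory.
Import numFieldNormedType.Exports.

Local Open Scope classical_set_scope.
Local Open Scope ring_scope.

(** The inequality defining the class of [Phi] bounds the absolute value of a
    defect that is linear in [f] by an expression that is linear in [Phi]. The
    triangle inequality and the homogeneity of the absolute value therefore
    show that adding functions adds their error functions ([affine_classD]) and
    that scaling by [a] scales the error function by [`|a|] ([affine_classZ]).
    Linear combinations follow by induction on the number of terms; the convex
    and symmetric cases are those where the weights [`|alpha i|] sum to [1], so
    that the combined error function is again [Phi]. *)

Lemma affine_class0 (R : realType) (I : set R) :
  affine_class I (0 : R -> R^o) (0 : R -> R^o).
Proof. by move=> x y t _ _ _; rewrite /= !mulr0 !subr0 normr0 addr0. Qed.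

Lemma affine_classD (R : realType) (I : set R) (Phi Psi f g : R -> R^o) :
  affine_class I Phi f -> affine_class I Psi g ->
  affine_class I (Phi + Psi) (f + g).
Proof.
move=> Hf Hg x y t Ix Iy t01; rewrite !fctE.
set z := t * x + _; set u := (1 - t) * `|_|; set v := t * `|_|.
have -> : f z + g z - t * (f x + g x) - (1 - t) * (f y + g y)
    = (f z - t * f x - (1 - t) * f y) + (g z - t * g x - (1 - t) * g y) :> R.
  by ring.
have -> : t * (Phi u + Psi u) + (1 - t) * (Phi v + Psi v)
    = (t * Phi u + (1 - t) * Phi v) + (t * Psi u + (1 - t) * Psi v) :> R.
  by ring.
by apply: le_trans (ler_normD _ _) _; apply: lerD; [exact: Hf | exact: Hg].
Qed.

Lemma affine_classZ (R : realType) (I : set R) (Phi f : R -> R^o) (a : R) :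
  affine_class I Phi f -> affine_class I (`|a| *: Phi) (a *: f).
Proof.
move=> Hf x y t Ix Iy t01; rewrite !fctE.
set z := t * x + _; set u := (1 - t) * `|_|; set v := t * `|_|.
have -> : a *: f z - t * (a *: f x) - (1 - t) * (a *: f y)
    = a * (f z - t * f x - (1 - t) * f y) :> R.
  by rewrite /GRing.scale /=; ring.
have -> : t * (`|a| *: Phi u) + (1 - t) * (`|a| *: Phi v)
    = `|a| * (t * Phi u + (1 - t) * Phi v) :> R.
  by rewrite /GRing.scale /=; ring.
by rewrite normrM; apply: ler_wpM2l => //; exact: Hf.
Qed.

Lemma affine_class_lincomb (R : realType) (I : set R) (n : nat)
    (Phi : 'I_n -> R -> R^o) (alpha : 'I_n -> R) :
  set_lincomb alpha (fun i => affine_class I (Phi i))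
    `<=` affine_class I (\sum_(i < n) `|alpha i| *: Phi i).
Proof.
move=> _ [f Hf <-].
apply: (big_ind2 (fun Psi g => affine_class I Psi g)).
- exact: affine_class0.
- by move=> Psi1 g1 Psi2 g2; exact: affine_classD.
- by move=> i _; exact/affine_classZ/Hf.
Qed.

Lemma error_functions_lincomb (R : realType) (I : set R) (n : nat)
    (Phi : 'I_n -> R -> R^o) (alpha : 'I_n -> R) :
  (forall i, error_functions I (Phi i)) ->
  error_functions I (\sum_(i < n) `|alpha i| *: Phi i).
Proof.
move=> Phi_ge0 u u_ge0 u_lt; rewrite fct_sumE.
by apply: sumr_ge0 => i _; apply: mulr_ge0 => //; exact: Phi_ge0.
Qed.

Lemma convex_affine_class (R : realType) (I : set R) (Phi : R -> R^o) :
  convex_set (affine_class I Phi).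
Proof.
move=> f g p; rewrite !inE => Hf Hg.
have := affine_classD (affine_classZ p%:num Hf) (affine_classZ (1 - p%:num) Hg).
by rewrite !ger0_norm ?subr_ge0 // -scalerDl subrKC scale1r.
Qed.

Lemma centrally_symmetric_affine_class (R : realType) (I : set R)
    (Phi : R -> R^o) :
  centrally_symmetric (affine_class I Phi).
Proof. by move=> f /(affine_classZ (-1)); rewrite normrN1 scale1r. Qed.

Theorem proposition2p2 (R : realType) (I : set R)
    (I_neq0 : I !=set0) (I_open : open I) (I_itv : is_interval I) :
  (forall (n : nat) (Phi : 'I_n -> R -> R^o) (alpha : 'I_n -> R),
     (forall i : 'I_n, error_functions I (Phi i)) ->
     error_functions I (\sum_(i < n) `|alpha i| *: Phi i) /\
     set_lincomb alpha (fun i : 'I_n => affine_class I (Phi i))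
       `<=` affine_class I (\sum_(i < n) `|alpha i| *: Phi i)) /\
  (forall Phi : R -> R^o, error_functions I Phi ->
     convex_set (affine_class I Phi) /\
     centrally_symmetric (affine_class I Phi)).
Proof.
split=> [n Phi alpha Phi_err|Phi _]; split.
- exact: error_functions_lincomb.
- exact: affine_class_lincomb.
- exact: convex_affine_class.
- exact: centrally_symmetric_affine_class.
Qed.
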